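(* For every nonnegative integer $n$, $$s_B(n)=\sum_{T\in\mathcal{PT}_B(n)}\mathrm{sign}_B(T)=\begin{cases}2^{n/2}, & n \text{ even},\\ 0, & n\text{ odd}.\end{cases}$$
   Context: Let $F$ be a Ferrers diagram (left-justified rows of weakly decreasing lengths) in which both empty rows and empty columns are allowed, with $k$ columns; its length $n$ is its number of rows plus columns. Label the $n$ steps of its south-east boundary $1,\dots,n$ from north-east to south-west; a row gets label $i$ if its right-end vertical boundary step is labeled $i$, a column gets label $j$ if its bottom horizontal boundary step is labeled $j$. The shifted diagram $\bar F$ is obtained by adding on top of $F$ $k$ new left-justified rows of lengths $1,2,\dots,k$ (from top to bottom); the rightmost cell of each added row is a diagonal cell, and an added row whose rightmost cell lies in column $j$ is labeled $-j$; other labels are as in $F$. The length of $\bar F$ is $n$. A type $B$ permutation tableau of length $n$ is a $0,1$-filling of such $\bar F$ such that (1) each column contains a $1$; (2) no $0$ has both a $1$ above it in its column and a $1$ to its left in its row; (3) a $0$ in a diagonal cell has no $1$ to its left in its row. $\mathcal{PT}_B(n)$ is the set of these. A $0$ not in a diagonal cell is row-restricted if it has a $1$ above it in its column (a $0$ in a diagonal cell is never row-restricted); a $0$ is column-restricted if it has a $1$ to its left in its row. $\mathrm{URR}_B(T)$ is the set of positive row labels $i$ such that row $i$ contains no row-restricted $0$ and contains at least one $1$; $\mathrm{URC}_B(T)$ is the set of column labels $j$ such that column $j$ contains no column-restricted $0$ and row $-j$ contains no row-restricted $0$. $\mathrm{ur}_B(T)=|\mathrm{URR}_B(T)\cup\mathrm{URC}_B(T)|$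 and $\mathrm{sign}_B(T)=(-1)^{\mathrm{ur}_B(T)}$. *)

(* Defs.v *)
From HB Require Import structures.
From mathcomp Require Import all_boot all_order all_algebra.
Set Implicit Arguments.
Unset Strict Implicit.
Unset Printing Implicit Defensive.
Import GRing.Theory.
Local Open Scope ring_scope.

(* Row lengths, from top to bottom, of a Ferrers diagram with r rows and k
   columns. A row of length 0 is an empty row; a column longer than no row is
   an empty column. *)
Definition ferrers (r k : nat) : Type :=
  {F : r.-tuple 'I_k.+1 | sorted geq [seq val l | l <- F]}.
HB.instance Definition _ r k := Finite.copy (ferrers r k)
  {F : r.-tuple 'I_k.+1 | sorted geq [seq val l | l <- F]}.

Definition row_length r k (F : ferrers r k) (a : 'I_r) : nat := tnth (val F) a.

Definition col_height r k (F : ferrers r k) (c : 'I_k) : nat :=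
  #|[set a : 'I_r | (c < row_length F a)%N]|.

(* Rows a and columns c are counted from 0, from the top and from the left.
   On the south-east boundary, walked from the north-east corner, the vertical
   step of row a is preceded by a vertical steps and k - row_length F a
   horizontal ones; the horizontal step of column c is preceded by
   col_height F c vertical steps and k - c.+1 horizontal ones. *)
Definition row_label r k (F : ferrers r k) (a : 'I_r) : nat :=
  (a + (k - row_length F a)).+1.
Definition col_label r k (F : ferrers r k) (c : 'I_k) : nat :=
  (col_height F c + (k - c.+1)).+1.

(* Rows of the shifted diagram: inl d is the added row of length d.+1, whose
   rightmost cell lies in column d, i.e. the row labelled - col_label F d;
   inr a is row a of F. *)
Definition srow (r k : nat) : finType := ('I_k + 'I_r)%type.

Definition srow_pos r k (x : srow r k) : nat :=
  match x with inl d => d | inr a => k + a end.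

Definition in_shifted r k (F : ferrers r k) (p : srow r k * 'I_k) : bool :=
  match p.1 with
  | inl d => (p.2 <= d)%N
  | inr a => (p.2 < row_length F a)%N
  end.

Definition cell r k (F : ferrers r k) : finType :=
  {p : srow r k * 'I_k | in_shifted F p}.

Definition cell_row r k (F : ferrers r k) (x : cell F) : srow r k := (val x).1.
Definition cell_col r k (F : ferrers r k) (x : cell F) : 'I_k := (val x).2.

Definition diagonal r k (F : ferrers r k) (x : cell F) : bool :=
  cell_row x == inl (cell_col x).

Definition filling r k (F : ferrers r k) : finType := {ffun cell F -> bool}.

Section Filling.

Variables (r k : nat) (F : ferrers r k) (T : filling F).

Definition one_above (x : cell F) : bool :=
  [exists y : cell F, [&& T y, cell_col y == cell_col x
                        & (srow_pos (cell_row y) < srow_pos (cell_row x))%N]].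

Definition one_left (x : cell F) : bool :=
  [exists y : cell F, [&& T y, cell_row y == cell_row x
                        & (cell_col y < cell_col x)%N]].

Definition is_PTB : bool :=
  [&& [forall c : 'I_k, exists x : cell F, (cell_col x == c) && T x],
      [forall x : cell F, ~~ T x ==> ~~ (one_above x && one_left x)]
    & [forall x : cell F, ~~ T x && diagonal x ==> ~~ one_left x]].

Definition row_restricted0 (x : cell F) : bool :=
  [&& ~~ T x, ~~ diagonal x & one_above x].

Definition col_restricted0 (x : cell F) : bool := ~~ T x && one_left x.

Definition has_row_restricted0 (i : srow r k) : bool :=
  [exists x : cell F, (cell_row x == i) && row_restricted0 x].

Definition has_col_restricted0 (c : 'I_k) : bool :=
  [exists x : cell F, (cell_col x == c) && col_restricted0 x].

(* Labels lie in {1, ..., r + k}, a subset of 'I_(r + k).+1. *)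
Definition URRB : {set 'I_(r + k).+1} :=
  [set l | [exists a : 'I_r,
     [&& val l == row_label F a, ~~ has_row_restricted0 (inr a)
       & [exists x : cell F, (cell_row x == inr a) && T x]]]].

Definition URCB : {set 'I_(r + k).+1} :=
  [set l | [exists c : 'I_k,
     [&& val l == col_label F c, ~~ has_col_restricted0 c
       & ~~ has_row_restricted0 (inl c)]]].

Definition urB : nat := #|URRB :|: URCB|.

Definition signB : int := (-1) ^+ urB.

End Filling.

(* 0,1-fillings of shifted diagrams of length n: k columns, n - k rows in F. *)
Definition shifted_filling (n : nat) : finType :=
  {k : 'I_n.+1 & {F : ferrers (n - k) k & filling F}}.

Definition PTB (n : nat) : {set shifted_filling n} :=
  [set T | is_PTB (tagged (tagged T))].

Definition sB (n : nat) : int := \sum_(T in PTB n) signB (tagged (tagged T)).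

(* Main.v *)
Require Import Defs.
From mathcomp Require Import all_boot all_order all_algebra zify.
Set Implicit Arguments.
Unset Strict Implicit.
Unset Printing Implicit Defensive.
Import Order.TTheory GRing.Theory Num.Theory.
Local Open Scope ring_scope.

(* Identify row -j with the label j, so that every boundary step labels exactly
   one row of the shifted diagram; the diagram then has a cell (l, j) for each
   west step j and each l <= j, and the last step of a tableau can be removed:
   a south step n adds an empty row, a west step n adds a leftmost column.

   Call a row free if it contains neither a row-restricted 0 nor a 0 in its
   diagonal cell; a new column has its 1s in free rows (or on its diagonal).
   Let b be the bottommost free row of a tableau t. If a new column has a 1
   above row b, then changing its entry in row b reverses the sign. The only
   column left over has its single 1 in row b, and its sign is the opposite of
   that of t if b is counted in ur_B(t), that of t otherwise. A south step keeps
   the sign, so the extensions of t contribute 0 or 2 sign(t). If t ends with a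
   west step, b is counted; if t ends with a south step, b is the last, empty,
   row, which is not. Hence s_B(n + 2) = 2 s_B(n). *)

(** * Tableaux as sequences of columns *)

(* Locked, so that rewriting with boolean identities does not look inside. *)
Definition exn (n : nat) (P : pred nat) : bool := locked (has P (iota 0 n)).

Lemma exnP n (P : pred nat) :
  reflect (exists2 i : nat, (i < n)%N & P i) (exn n P).
Proof.
rewrite /exn -lock.
by apply: (iffP hasP) => -[i]; rewrite ?mem_iota => ? ?; exists i;
  rewrite ?mem_iota.
Qed.

Lemma exnS n (P : pred nat) : exn n.+1 P = exn n P || P n.
Proof.
apply/exnP/orP => [[i]|[/exnP[i lt_in Pi]|Pn]]; last by exists n.
  rewrite ltnS leq_eqVlt => /predU1P[-> Pn|lt_in Pi]; first by right.
  by left; apply/exnP; exists i.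
by exists i => //; apply: ltnW.
Qed.

Lemma eq_exn n (P Q : pred nat) :
  (forall i, (i < n)%N -> P i = Q i) -> exn n P = exn n Q.
Proof.
move=> eqPQ; rewrite /exn -!lock; apply: eq_in_has => i.
by rewrite mem_iota; apply: eqPQ.
Qed.

Definition column (m : nat) : finType := {ffun 'I_m -> bool}.

Definition colv m (c : column m) (l : nat) : bool := oapp c false (insub l).

Lemma colv_lt m (c : column m) l : colv c l -> (l < m)%N.
Proof. by rewrite /colv; case: insubP. Qed.

Lemma colvE m (c : column m) (i : 'I_m) : colv c i = c i.
Proof. by rewrite /colv valK. Qed.

Lemma colv_ffun m (P : nat -> bool) l :
  colv ([ffun i : 'I_m => P i] : column m) l = (l < m)%N && P l.
Proof.
rewrite /colv; case: insubP => [i -> <-|]; first by rewrite /= ffunE.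
by move/negPf->.
Qed.

(* The west steps of a tableau, with their columns: the last component is the
   step of largest label, None for a south step. *)
Fixpoint tab (n : nat) : finType :=
  if n is m.+1 then (tab m * option (column m.+1))%type else unit.

Fixpoint west n : tab n -> nat -> bool :=
  if n is m.+1 then
    fun t j => if j == m then isSome t.2 else west t.1 j
  else fun _ _ => false.

Fixpoint entry n : tab n -> nat -> nat -> bool :=
  if n is m.+1 then
    fun t l j => if j == m then oapp (fun c => colv c l) false t.2
                 else entry t.1 l j
  else fun _ _ _ => false.

Lemma west_lt n (t : tab n) j : west t j -> (j < n)%N.
Proof.
elim: n t => //= n IHn t; case: eqP => [-> //|_ /IHn]; exact: ltnW.
Qed.

Lemma entryP n (t : tab n) l j : entry t l j -> (l <= j)%N && west t j.
Proof.
elim: n t => //= n IHn t; case: eqP => [->|_ /IHn //].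
by case: t.2 => //= c /colv_lt; rewrite ltnS => ->.
Qed.

Lemma entry_row_lt n (t : tab n) l j : entry t l j -> (l < n)%N.
Proof. by case/entryP/andP => lj /west_lt; apply: leq_ltn_trans. Qed.

(** * Restricted zeros, validity and sign in terms of labels *)

Section Stats.
Variables (n : nat) (t : tab n).

(* Rows are ordered from top to bottom by increasing key: first the added rows
   by decreasing label, then the rows of F by increasing label. *)
Definition key (l : nat) : int := if west t l then Negz l else Posz l.

Lemma key_inj : injective key.
Proof. by move=> i j; rewrite /key; do 2!case: ifP => _; lia. Qed.

Definition above (l j : nat) : bool :=
  exn n (fun i => entry t i j && (key i < key l)).
(** Labels run from north-east to south-west, so columns of larger label lie further left. *)
Definition leftof (l j : nat) : bool :=
  exn n (fun i => entry t l i && (j < i)%N).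
(** The negation of free. With [west t j], the disjunct [l == j] singles out the diagonal cell of an
    added row; in a row of the Ferrers diagram only row-restricted 0s block. *)
Definition blocked (l : nat) : bool :=
  exn n (fun j => [&& (l <= j)%N, west t j, ~~ entry t l j
                    & (l == j) || above l j]).
Definition nonzero (l : nat) : bool := exn n (entry t l).
Definition col_bad (j : nat) : bool :=
  exn n (fun l => [&& (l <= j)%N, ~~ entry t l j & leftof l j]).
Definition row_bad (l : nat) : bool :=
  exn n (fun j => [&& (l < j)%N, west t j, ~~ entry t l j & above l j]).

Definition counted (l : nat) : bool :=
  if west t l then ~~ col_bad l && ~~ row_bad l
  else ~~ blocked l && nonzero l.

(** The second conjunct merges the conditions on 0s: a diagonal 0 is treated as if it had a 1 above
    it. *)
Definition valid : bool :=
  ~~ exn n (fun j => west t j && ~~ exn n (fun l => entry t l j)) &&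
  ~~ exn n (fun j => west t j && exn n (fun l =>
      [&& (l <= j)%N, ~~ entry t l j, (l == j) || above l j & leftof l j])).

Definition sgn : int := \prod_(l < n) (-1) ^+ counted l.

End Stats.

(** * The effect of one more boundary step *)

Section Step.
Variables (n : nat) (t : tab n).

Definition addS : tab n.+1 := (t, None).
Definition addW (c : column n.+1) : tab n.+1 := (t, Some c).

Let westE (o : option (column n.+1)) l :
  (l < n)%N -> west ((t, o) : tab n.+1) l = west t l.
Proof. by move=> ln /=; rewrite ltn_eqF. Qed.

Let keyE (o : option (column n.+1)) l :
  (l < n)%N -> key ((t, o) : tab n.+1) l = key t l.
Proof. by move=> ln; rewrite /key westE. Qed.

Let entryE (o : option (column n.+1)) l j :
  (j < n)%N -> entry ((t, o) : tab n.+1) l j = entry t l j.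
Proof. by move=> jn /=; rewrite ltn_eqF. Qed.

Let aboveE (o : option (column n.+1)) l j : (l < n)%N -> (j < n)%N ->
  above ((t, o) : tab n.+1) l j = above t l j.
Proof.
move=> ln jn; rewrite /above exnS (entryE _ _ jn).
have -> : entry t n j = false by apply/negP => /entryP; lia.
by rewrite orbF; apply: eq_exn => i lt_in; rewrite entryE // !keyE.
Qed.

Let entry_new l j : (j < n)%N -> (n <= l)%N -> entry t l j = false.
Proof. by move=> *; apply/negP => /entryP; lia. Qed.

Lemma blocked_addS l : (l < n)%N -> blocked addS l = blocked t l.
Proof.
move=> ln; rewrite /blocked exnS /= eqxx /= andbF orbF.
by apply: eq_exn => j jn; rewrite aboveE // !(ltn_eqF jn).
Qed.

Lemma blocked_addS_new : blocked addS n = false.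
Proof.
rewrite /blocked exnS /= eqxx /= andbF orbF.
by apply/exnP => -[j jn /andP[]]; lia.
Qed.

Lemma leftof_addS l j : leftof addS l j = leftof t l j.
Proof.
rewrite /leftof exnS /= eqxx /= orbF.
by apply: eq_exn => i lt_in; rewrite ltn_eqF.
Qed.

Lemma counted_addS l : (l < n)%N -> counted addS l = counted t l.
Proof.
move=> ln; rewrite /counted westE // blocked_addS //.
congr (if _ then _ else _).
  congr (~~ _ && ~~ _); rewrite /col_bad /row_bad exnS.
    rewrite [X in _ || X]/= leqNgt ln /= orbF; apply: eq_exn => i lt_in.
    by rewrite leftof_addS ltn_eqF.
  rewrite [X in _ || X]/= eqxx /= andbF orbF; apply: eq_exn => i lt_in.
  by rewrite aboveE // ltn_eqF.
congr (_ && _); rewrite /nonzero exnS /= eqxx /= orbF; apply: eq_exn => i lt_in.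
by rewrite ltn_eqF.
Qed.

(** The new row is empty, and a row of the Ferrers diagram is counted only if it contains a 1. *)
Lemma counted_addS_new : counted addS n = false.
Proof.
rewrite /counted /= eqxx /= /nonzero exnS /= eqxx /= orbF.
rewrite andbC; apply/andP => -[/exnP[i lt_in]].
by rewrite /= ltn_eqF // entry_new.
Qed.

Lemma sgn_addS : sgn addS = sgn t.
Proof.
rewrite /sgn big_ord_recr /= counted_addS_new mulr1; apply: eq_bigr => i _.
by rewrite counted_addS.
Qed.

Lemma valid_addS : valid addS = valid t.
Proof.
rewrite /valid; congr (~~ _ && ~~ _); rewrite exnS [X in _ || X]/= eqxx /= orbF;
  apply: eq_exn => j jn; rewrite !(ltn_eqF jn); congr (_ && _).
  congr (~~ _); rewrite exnS (entry_new jn (leqnn n)) orbF.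
  by apply: eq_exn => l ln.
rewrite exnS leqNgt jn /= orbF; apply: eq_exn => l ln.
by rewrite aboveE // leftof_addS.
Qed.

Section NewColumn.
Variable c : column n.+1.

(* Row n, on top of all others, is the diagonal row of the new column. *)
Definition colabove (l : nat) : bool :=
  exn n.+1 (fun i => colv c i && (key (addW c) i < key (addW c) l)).

Lemma key_new : key (addW c) n = Negz n.
Proof. by rewrite /key /= eqxx. Qed.

Lemma key_addW l : (l < n)%N -> key (addW c) l = key t l.
Proof. exact: keyE. Qed.

Lemma key_new_lt l : (l < n)%N -> key (addW c) n < key (addW c) l.
Proof. by rewrite key_new /key => ln; case: ifP => _; lia. Qed.

Lemma above_new l : above (addW c) l n = colabove l.
Proof. by apply: eq_exn => i _; rewrite /= eqxx. Qed.

(** The older columns do not change, so the only new candidate for a row-restricted 0 is the cell of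
    row [l] in the new column. *)
Lemma blocked_addW l : (l < n)%N ->
  blocked (addW c) l = blocked t l || (~~ colv c l && colabove l).
Proof.
move=> ln; rewrite /blocked exnS above_new /= eqxx /= (ltnW ln) (ltn_eqF ln) /=.
congr (_ || _).
by apply: eq_exn => j jn; rewrite aboveE // !(ltn_eqF jn).
Qed.

Lemma blocked_addW_new : blocked (addW c) n = ~~ colv c n.
Proof.
rewrite /blocked exnS /= eqxx /= leqnn /= andbT.
by case: exnP => // -[j jn /andP[]]; lia.
Qed.

Lemma nonzero_addW l : nonzero (addW c) l = nonzero t l || colv c l.
Proof.
rewrite /nonzero exnS /= eqxx /=; congr (_ || _).
by apply: eq_exn => j jn; rewrite ltn_eqF.
Qed.

Lemma leftof_addW l j : (j < n)%N ->
  leftof (addW c) l j = leftof t l j || colv c l.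
Proof.
move=> jn; rewrite /leftof exnS /= eqxx /= jn andbT; congr (_ || _).
by apply: eq_exn => i lt_in; rewrite ltn_eqF.
Qed.

Lemma counted_addW_S l : (l < n)%N -> ~~ west t l ->
  counted (addW c) l =
    [&& ~~ blocked t l, colv c l || ~~ colabove l & nonzero t l || colv c l].
Proof.
move=> ln Wl; rewrite /counted westE // (negPf Wl) blocked_addW //.
by rewrite nonzero_addW negb_or negb_and negbK andbA.
Qed.

(** A new column can spoil [l] in two ways: a 1 in row [i] makes a 0 in cell ([i], [l])
    column-restricted, and a 0 below a 1 of the new column makes row [l] row-restricted. *)
Lemma counted_addW_W l : (l < n)%N -> west t l ->
  counted (addW c) l =
    [&& counted t l,
        ~~ exn n (fun i => [&& (i <= l)%N, ~~ entry t i l & colv c i])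
      & colv c l || ~~ colabove l].
Proof.
move=> ln Wl; rewrite /counted westE // Wl.
have -> : row_bad (addW c) l = row_bad t l || (~~ colv c l && colabove l).
  rewrite /row_bad exnS above_new /= eqxx /= ln /=; congr (_ || _).
  by apply: eq_exn => j jn; rewrite aboveE // !(ltn_eqF jn).
have -> : col_bad (addW c) l = col_bad t l ||
    exn n (fun i => [&& (i <= l)%N, ~~ entry t i l & colv c i]).
  rewrite /col_bad exnS [X in _ || X]/= leqNgt ln orbF.
  apply/exnP/orP => [[i lt_in]|].
    rewrite leftof_addW // entryE // => /and3P[il Eil /orP[Li|ci]].
      by left; apply/exnP; exists i => //; apply/and3P.
    by right; apply/exnP; exists i => //; apply/and3P.
  case=> /exnP[i lt_in /and3P[il Eil Hi]]; exists i => //;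
    by rewrite leftof_addW // entryE // il Eil Hi ?orbT.
by rewrite !negb_or negb_and negbK andbACA.
Qed.

(** The new column is leftmost, and its added row consists of the diagonal cell alone; neither can
    hold a restricted 0 of the relevant kind. *)
Lemma counted_addW_new : counted (addW c) n.
Proof.
rewrite /counted /= eqxx /=; apply/andP; split; apply/exnP => -[i].
  move=> _ /and3P[_ _ /exnP[j jn /andP[_]]]; lia.
move=> lt_in /andP[]; lia.
Qed.

Lemma sgn_addW : sgn (addW c) = - \prod_(l < n) (-1) ^+ counted (addW c) l.
Proof. by rewrite /sgn big_ord_recr /= counted_addW_new expr1 mulrN1. Qed.

(** A 1 at the left end of row [l] lies to the left of every 0 of that row, so [l] must have no 0
    that is diagonal or below a 1, that is, [l] must be free. *)
Lemma valid_addW : valid (addW c) =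
  [&& valid t, exn n.+1 (colv c)
    & ~~ exn n (fun l => colv c l && blocked t l)].
Proof.
apply/idP/idP => [/andP[/exnP H1 /exnP H2]|
                  /and3P[/andP[/exnP H1 /exnP H2] H3 H4]].
  apply/and3P; split.
  - apply/andP; split; apply/exnP => -[j jn /andP[Wj Hj]].
      case: H1; exists j; rewrite ?ltnS 1?ltnW // westE // Wj andTb exnS.
      rewrite negb_or entryE // entry_new // andbT.
      by apply: contra Hj => /exnP[i lt_in]; rewrite entryE // => Ei;
        apply/exnP; exists i.
    case: H2; exists j; rewrite ?ltnS 1?ltnW // westE // Wj andTb.
    case/exnP: Hj => l ln /and4P[lj El Al Ll]; apply/exnP; exists l.
      exact: ltnW.
    by rewrite lj entryE // El aboveE // Al leftof_addW // Ll.
  - case E: (exn _ _) => //; case: H1; exists n => //; rewrite /= eqxx /=.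
    by rewrite -[X in ~~ X]/(exn n.+1 (colv c)) E.
  apply/exnP => -[l ln /andP[cl /exnP[j jn /and4P[lj Wj El Al]]]].
  case: H2; exists j; rewrite ?ltnS 1?ltnW // westE // Wj andTb.
  apply/exnP; exists l; first exact: ltnW.
  by rewrite lj entryE // El aboveE // Al leftof_addW // cl orbT.
apply/andP; split; apply/exnP => -[j]; rewrite ltnS leq_eqVlt
    => /predU1P[->|jn].
- rewrite /= eqxx /=; apply/negP; rewrite negbK; exact: H3.
- rewrite westE // => /andP[Wj Hj]; case: H1; exists j; rewrite // Wj andTb.
  apply: contra Hj => /exnP[i lt_in Ei]; apply/exnP; exists i.
    exact: ltnW.
  by rewrite entryE.
(* Nothing lies to the left of column [n]. *)
- move=> /andP[_ /exnP[l _ /and4P[_ _ _ /exnP[i lt_in /andP[_]]]]]; lia.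
rewrite westE // => /andP[Wj /exnP[l ln /and4P[lj El Al Ll]]].
have {}ln : (l < n)%N by lia.
move: El Al Ll; rewrite entryE // aboveE // leftof_addW // => El Al.
(* An old 1 to the left contradicts validity of [t]; a new one lies in a blocked row. *)
case/orP => [Ll|cl].
  case: H2; exists j => //; rewrite Wj /=; apply/exnP; exists l => //.
  by rewrite lj El Al.
case/exnP: H4; exists l; rewrite // cl /=; apply/exnP; exists j => //.
by rewrite lj Wj El.
Qed.

End NewColumn.
End Step.

(** * The sign-reversing involution *)

Section Cancellation.
Variables (n : nat) (t : tab n).
Hypothesis t_valid : valid t.

Let zero_valid l j : (l <= j)%N -> west t j -> ~~ entry t l j ->
  (l == j) || above t l j -> leftof t l j -> False.
Proof.
move=> lj Wj El Al Ll; case/andP: t_valid => _ /exnP[].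
exists j; first exact: (west_lt Wj).
rewrite Wj; apply/exnP; exists l; last by rewrite lj El Al Ll.
exact: leq_ltn_trans lj (west_lt Wj).
Qed.

Let free_entry l j : ~~ blocked t l -> (l <= j)%N -> west t j ->
  (l == j) || above t l j -> entry t l j.
Proof.
move=> Fl lj Wj Al; apply: contraR Fl => El; apply/exnP; exists j.
  exact: west_lt Wj.
by rewrite lj Wj El Al.
Qed.

Let aboveP i l j : entry t i j -> key t i < key t l -> above t l j.
Proof.
move=> Ei kil; apply/exnP; exists i; last by rewrite Ei.
exact: entry_row_lt Ei.
Qed.

(** A free row has a 1 on its diagonal, and this is the top cell of column [b]. A column-restricted
    0 in that column would thus have a 1 above it and a 1 to its left. *)
Lemma counted_free_west b : west t b -> ~~ blocked t b -> counted t b.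
Proof.
move=> Wb Fb; rewrite /counted Wb; apply/andP; split; apply/exnP => -[i _].
  move=> /and3P[ib Ei]; apply: zero_valid => //.
  have Ebb : entry t b b by apply: free_entry; rewrite ?eqxx.
  have ltib : (i < b)%N.
    by rewrite ltn_neqAle ib andbT; apply: contraNneq Ei => ->.
  rewrite (aboveP Ebb) ?orbT //.
  by rewrite /key Wb; case: ifP => _; lia.
case/and4P => bi Wi Ei Ai.
by rewrite (free_entry Fb (ltnW bi) Wi) ?Ai ?orbT in Ei.
Qed.

(** The row [y] is [l] itself if its diagonal cell holds a 1, and otherwise the row of the topmost 1
    of column [l]. *)
Lemma counted_west_top l : west t l -> counted t l ->
  exists y, [/\ entry t y l, ~~ blocked t y & key t l <= key t y].
Proof.
move=> Wl; rewrite /counted Wl => /andP[/exnP Cl /exnP Rl].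
have ln := west_lt Wl.
have [Ell|Ell] := boolP (entry t l l).
  exists l; split=> //; apply/exnP => -[j jn /and4P[]].
  rewrite leq_eqVlt => /predU1P[<-|lj Wj Ej]; first by rewrite Ell.
  rewrite ltn_eqF // => Aj.
  by case: Rl; exists j; rewrite ?lj ?Wj ?Ej.
have [i0 Ei0] : exists i : 'I_n, entry t i l.
  have /exnP[i lt_in Ei] : exn n (fun i => entry t i l).
    case/andP: t_valid => /exnP V _; case E: (exn _ _) => //.
    by case: V; exists l; rewrite // Wl E.
  by exists (Ordinal lt_in).
have [y Ey miny] := @arg_minP _ int _ i0 (fun i => entry t i l)
  (fun i : 'I_n => key t i) Ei0.
have yl : (y < l)%N.
  rewrite ltn_neqAle; case/andP: (entryP Ey) => -> _; rewrite andbT.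
  by apply: contraNneq Ell => {1}<-.
have kly : key t l < key t y by rewrite /key Wl; case: ifP => _; lia.
exists y; split; [by []| |exact: ltW].
apply/exnP => -[j jn /and4P[yj Wj Eyj]].
(* Suppose the 0 in cell ([y], [j]) blocks row [y]. If column [j] is to the right of column [l],
   that 0 has the 1 of column [l] to its left, against validity. Otherwise it lies below a 1 in some
   row [i]. *)
case: (ltngtP j l) => [jl|lj|jl]; last by rewrite jl Ey in Eyj.
  move=> Ayj; apply: (zero_valid yj Wj Eyj Ayj).
  by apply/exnP; exists l; rewrite // Ey.
rewrite ltn_eqF ?(ltn_trans yl) //= => /exnP[i lt_in /andP[Eij kiy]].
(* A 1 here would lie to the left of the diagonal 0 of row [l]. *)
have Elj : ~~ entry t l j.
  apply/negP => Elj; apply: (zero_valid (leqnn l) Wl Ell).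
    by rewrite eqxx.
  by apply/exnP; exists j; rewrite // Elj.
(* Otherwise the 0 in cell ([l], [j]) would be row-restricted. *)
have kli : key t l < key t i.
  rewrite ltNge; apply/negP; rewrite le_eqVlt => /predU1P[/key_inj il|kil].
    by rewrite -il Eij in Elj.
  by case: Rl; exists j; rewrite // lj Wj Elj (aboveP Eij).
have il : (i <= l)%N.
  by move: kiy kli; rewrite /key Wl; do 2!case: ifP => _; lia.
(* Row [i] is above the topmost 1 of column [l], so cell ([i], [l]) holds a 0; the 1 in column [j]
   makes it column-restricted. *)
case: Cl; exists i; rewrite // il /=; apply/andP; split.
  by apply/negP => Eil; move: kiy; rewrite ltNge (miny (Ordinal lt_in)).
by apply/exnP; exists j; rewrite // Eij.
Qed.

Variable b : nat.
Hypothesis bn : (b < n)%N.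
Hypothesis Fb : ~~ blocked t b.
Hypothesis b_bottom :
  forall l, (l < n)%N -> ~~ blocked t l -> key t l <= key t b.

(** The free row [y] with a 1 in column [l] is [b] or lies above [b]; in the latter case the cell of
    [b] in column [l], if there is one, is below a 1 and holds a 1 because [b] is free. *)
Let counted_west_bottom l : west t l -> counted t l ->
  key t l <= key t b /\ ((b <= l)%N -> entry t b l).
Proof.
move=> Wl /(counted_west_top Wl)[y [Ey Fy kly]].
have yn := entry_row_lt Ey.
have kyb := b_bottom yn Fy; split; first exact: le_trans kyb.
move=> bl; move: kyb; rewrite le_eqVlt => /predU1P[/key_inj <-//|kyb].
by apply: free_entry; rewrite // (aboveP Ey) ?orbT.
Qed.

Let colabove_off (c c' : column n.+1) l : (l < n)%N -> key t l <= key t b ->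
    (forall i, i != b -> colv c i = colv c' i) ->
  colabove t c l = colabove t c' l.
Proof.
move=> ln klb cc'; apply: eq_exn => i; rewrite ltnS leq_eqVlt.
case/predU1P => [->|lt_in].
  by rewrite cc' ?(gtn_eqF bn) // !key_new !key_addW.
rewrite !key_addW //; have [->|/cc'->//] := eqVneq i b.
by rewrite [_ < _]ltNge klb !andbF.
Qed.

(** The entry in row [b] affects the other labels only by lying above their rows or by restricting a
    0 of row [b]. A label still able to be counted has its row above [b], and a counted column has
    no 0 in row [b]. *)
Lemma counted_addW_off (c c' : column n.+1) l : (l < n)%N -> l != b ->
    (forall i, i != b -> colv c i = colv c' i) ->
  counted (addW t c) l = counted (addW t c') l.
Proof.
move=> ln lb cc'; have [Wl|Wl] := boolP (west t l).
  rewrite !counted_addW_W //.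
  have [Cl|//] := boolP (counted t l).
  have [klb Ebl] := counted_west_bottom Wl Cl.
  rewrite (colabove_off _ _ cc') // cc' // !andTb; congr (~~ _ && _).
  apply: eq_exn => i _; have [->|/cc'->//] := eqVneq i b.
  by case: (leqP b l) => //= /Ebl->.
rewrite !counted_addW_S // cc' //.
have [//|Fl] := boolP (blocked t l).
by rewrite (colabove_off _ _ cc') ?b_bottom.
Qed.

(** Comparison with the zero column, which alters none of the older labels. *)
Lemma counted_addW0 (c : column n.+1) l : (l < n)%N -> l != b ->
  (forall i, i != b -> colv c i = false) -> counted (addW t c) l = counted t l.
Proof.
move=> ln lb c0.
have v0 i : colv ([ffun=> false] : column n.+1) i = false.
  by rewrite (colv_ffun _ (fun=> false)) andbF.
rewrite (@counted_addW_off c [ffun=> false]) //; last by move=> i /c0->.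
have A0 : colabove t [ffun=> false] l = false.
  by apply/exnP => -[i _]; rewrite v0.
have [Wl|Wl] := boolP (west t l).
  rewrite counted_addW_W // A0 orbT andbT.
  suff -> : exn n (fun i => [&& (i <= l)%N, ~~ entry t i l
      & colv ([ffun=> false] : column n.+1) i]) = false by rewrite andbT.
  by apply/exnP => -[i _]; rewrite v0 !andbF.
by rewrite counted_addW_S // A0 v0 orbF /counted (negPf Wl).
Qed.

(** Any 1 outside row [b] is in a free row or on the new diagonal, hence above [b]; a 0 in row [b]
    is then row-restricted. *)
Lemma counted_addW_bottom (c : column n.+1) : valid (addW t c) ->
  (exists2 i, i != b & colv c i) -> counted (addW t c) b = colv c b.
Proof.
rewrite valid_addW => /and3P[_ _ /exnP Vc] [i ib ci].
have Cb : colabove t c b.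
  apply/exnP; exists i; rewrite ?ci; first exact: colv_lt ci.
  have := colv_lt ci; rewrite ltnS leq_eqVlt => /predU1P[->|lt_in].
    exact: key_new_lt.
  rewrite !key_addW // lt_neqAle (inj_eq (@key_inj _ _)) ib b_bottom //.
  by apply/negP => Bi; case: Vc; exists i; rewrite // ci.
have [Wb|Wb] := boolP (west t b); last first.
  by rewrite counted_addW_S // Fb Cb orbF /=; case: (colv c b); rewrite ?orbT.
rewrite counted_addW_W // counted_free_west // Cb orbF /=.
(* A column-restricted 0 of column [b] in row [j] would lie below the diagonal 1 of [b], so row [j]
   would be blocked and could not receive the new 1. *)
case: exnP => // -[j jn /and3P[jb Ej cj]]; case: Vc; exists j => //.
rewrite cj; apply/exnP; exists b => //; rewrite jb Wb Ej /=.
have Ebb : entry t b b by apply: free_entry; rewrite ?eqxx.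
rewrite (aboveP Ebb) ?orbT // /key Wb.
have : j != b by apply: contraNneq Ej => ->.
by case: ifP => _; lia.
Qed.

Definition unitcol : column n.+1 := [ffun i => val i == b].
Definition toggle (c : column n.+1) : column n.+1 :=
  [ffun i => (val i == b) (+) c i].

Lemma colv_unitcol i : colv unitcol i = (i == b).
Proof.
rewrite /unitcol (colv_ffun _ (fun i => i == b)).
by case: eqP => [->|_]; rewrite ?andbF // ltnS ltnW.
Qed.

Lemma colv_toggle c i : colv (toggle c) i = (i == b) (+) colv c i.
Proof.
rewrite /colv; case: insubP => [j _ <-|]; first by rewrite /= ffunE.
by rewrite -ltnNge; case: eqP => [->|//]; lia.
Qed.

Lemma toggleK : involutive toggle.
Proof. by move=> c; apply/ffunP => i; rewrite !ffunE addbA addbb. Qed.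

Lemma valid_unitcol : valid (addW t unitcol).
Proof.
rewrite valid_addW t_valid /=; apply/andP; split.
  by apply/exnP; exists b; rewrite ?colv_unitcol // ltnS ltnW.
by apply/exnP => -[l _]; rewrite colv_unitcol => /andP[/eqP->]; apply/negP.
Qed.

(** The right-hand side does not involve the entry in row [b], so the set of these columns is stable
    under [toggle]. *)
Lemma valid_not_unitcol c : valid (addW t c) && (c != unitcol) =
  exn n.+1 (fun i => (i != b) && colv c i) &&
  ~~ exn n (fun l => [&& l != b, colv c l & blocked t l]).
Proof.
have -> : exn n (fun l => [&& l != b, colv c l & blocked t l]) =
          exn n (fun l => colv c l && blocked t l).
  apply: eq_exn => l _; have [->|//] := eqVneq l b.
  by rewrite (negPf Fb) andbF.
rewrite valid_addW t_valid /= andbAC; congr (_ && _).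
apply/andP/exnP => [[/exnP[i lt_in ci] neq]|[i lt_in /andP[ib ci]]].
  have [ib|ib] := eqVneq i b; last by exists i; rewrite ?ib.
  case: (exnP n.+1 (fun i => (i != b) && colv c i)) => // nE.
  case/eqP: neq; apply/ffunP => j; rewrite ffunE -colvE.
  have [->|jb] := eqVneq (j : nat) b; first by rewrite -ib ci.
  by apply/negP => cj; case: nE; exists j; rewrite // jb.
split; first by apply/exnP; exists i.
by apply: contraNneq ib => eqc; rewrite -colv_unitcol -eqc.
Qed.

Lemma toggle_valid c :
  valid (addW t (toggle c)) && (toggle c != unitcol) =
  valid (addW t c) && (c != unitcol).
Proof.
rewrite !valid_not_unitcol; congr (_ && ~~ _); apply: eq_exn => i _;
  by rewrite colv_toggle; case: eqVneq.
Qed.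

Lemma sgn_toggle c : valid (addW t c) && (c != unitcol) ->
  sgn (addW t (toggle c)) = - sgn (addW t c).
Proof.
move=> Pc; have := Pc; rewrite valid_not_unitcol => /andP[].
move=> /exnP[i lt_in /andP[ib ci]] _.
have /andP[Vt _] : valid (addW t (toggle c)) && (toggle c != unitcol).
  by rewrite toggle_valid.
case/andP: Pc => Vc _.
rewrite !sgn_addW (bigD1 (Ordinal bn)) //= [in RHS](bigD1 (Ordinal bn)) //=.
rewrite (counted_addW_bottom Vc); last by exists i.
rewrite (counted_addW_bottom Vt); last first.
  by exists i; rewrite // colv_toggle (negPf ib).
rewrite colv_toggle eqxx addTb signrN mulNr; congr (- - (_ * _)).
apply: eq_bigr => l lb; rewrite (@counted_addW_off _ c) // => j jb.
by rewrite colv_toggle (negPf jb).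
Qed.

Lemma counted_addW_unitcol : counted (addW t unitcol) b.
Proof.
have ub : colv unitcol b by rewrite colv_unitcol eqxx.
have [Wb|Wb] := boolP (west t b); last first.
  by rewrite counted_addW_S // Fb ub orbT.
rewrite counted_addW_W // counted_free_west // ub andbT /=.
apply/exnP => -[i _]; rewrite colv_unitcol => /and3P[_ Ei /eqP ib].
by rewrite ib free_entry ?eqxx in Ei.
Qed.

(** Only [unitcol] survives the cancellation. There [b] is counted, which offsets the factor -1 of
    the new column, and the other labels keep their status; what remains is [sgn t] without the
    factor of [b]. *)
Lemma sum_addW : \sum_(c | valid (addW t c)) sgn (addW t c) =
  if counted t b then - sgn t else sgn t.
Proof.
rewrite (bigD1 unitcol) ?valid_unitcol //= [X in _ + X](_ : _ = 0) ?addr0.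
  rewrite sgn_addW /sgn (bigD1 (Ordinal bn)) //= counted_addW_unitcol.
  rewrite [in RHS](bigD1 (Ordinal bn)) //=.
  rewrite (eq_bigr (fun l : 'I_n => (-1) ^+ counted t l)); last first.
    move=> l lb; rewrite counted_addW0 // => i ib.
    by rewrite colv_unitcol (negPf ib).
  by case: (counted t b); rewrite ?mulN1r ?opprK ?mul1r.
set S := \sum_(_ | _) _; suff : S = - S by lia.
rewrite {1}/S (reindex_inj (inv_inj toggleK)) /= (eq_bigl _ _ toggle_valid).
by rewrite -sumrN; apply: eq_bigr => c /sgn_toggle.
Qed.

End Cancellation.

(** * The bottommost free row and the recurrence for the signed sum *)

Lemma colv_free n (t : tab n) (c : column n.+1) i :
  valid (addW t c) -> colv c i -> ~~ blocked (addW t c) i.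
Proof.
rewrite valid_addW => /and3P[_ _ /exnP Fc] ci; have := colv_lt ci.
rewrite ltnS leq_eqVlt => /predU1P[eq_in|lt_in].
  by rewrite eq_in in ci *; rewrite blocked_addW_new ci.
rewrite blocked_addW // ci orbF; apply/negP => Bi.
by case: Fc; exists i; rewrite // ci.
Qed.

(** The last step provides one: a row with a 1 in the last column, or the last, empty row. *)
Lemma free_row n (t : tab n.+1) : valid t ->
  exists2 b, (b < n.+1)%N & ~~ blocked t b.
Proof.
case: t => t [c|] Vt.
  have := Vt; rewrite [valid _]valid_addW => /and3P[_ /exnP[i lt_in ci] _].
  by exists i => //; apply: (colv_free Vt ci).
by exists n; rewrite // [blocked _ _]blocked_addS_new.
Qed.

Lemma bottom_free_row n (t : tab n.+1) : valid t ->
  exists b, [/\ (b < n.+1)%N, ~~ blocked t b &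
    forall l, (l < n.+1)%N -> ~~ blocked t l -> key t l <= key t b].
Proof.
case/free_row => b0 b0n Fb0.
have [b Fb maxb] := @arg_maxP _ int _ (Ordinal b0n)
  (fun i => ~~ blocked t i) (fun i : 'I_n.+1 => key t i) Fb0.
by exists b; split=> // l ln Fl; apply: (maxb (Ordinal ln)).
Qed.

(* The bottommost free row has a 1 in the last column: otherwise it would
   have a 0 below a 1 there. *)
Lemma counted_bottom_addW n (t : tab n) (c : column n.+1) b :
  valid (addW t c) -> (b < n.+1)%N -> ~~ blocked (addW t c) b ->
  (forall l, (l < n.+1)%N -> ~~ blocked (addW t c) l ->
     key (addW t c) l <= key (addW t c) b) ->
  counted (addW t c) b.
Proof.
move=> Vc bn Fb b_bottom.
have [Wb|Wb] := boolP (west (addW t c) b); first exact: counted_free_west.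
rewrite /counted (negPf Wb) Fb /= nonzero_addW; apply/orP; right.
have {}bn : (b < n)%N.
  move: bn; rewrite ltnS leq_eqVlt => /predU1P[eb|//].
  by rewrite eb /= eqxx in Wb.
have := Vc; rewrite valid_addW => /and3P[_ /exnP[i lt_in ci] _].
have Fi := colv_free Vc ci.
have := b_bottom i lt_in Fi; rewrite le_eqVlt.
move=> /predU1P[/key_inj <-//|kib].
apply: contraR Fb => cb; rewrite blocked_addW // cb; apply/orP; right.
by apply/exnP; exists i; rewrite // ci.
Qed.

Definition sgn_sum n : int := \sum_(t : tab n | valid t) sgn t.

Lemma big_option (T : finType) (P : pred (option T)) (G : option T -> int) :
  \sum_(o | P o) G o =
  (if P None then G None else 0) + \sum_(x | P (Some x)) G (Some x).
Proof.
rewrite big_mkcond /= (bigD1 None) //= [in RHS]big_mkcond /=; congr (_ + _).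
have -> : \sum_(o : option T | o != None) (if P o then G o else 0) =
    \sum_(o in Some @: setT) (if P o then G o else 0).
  apply: eq_bigl => -[x|]; last by apply/esym/negP => /imsetP[].
  by rewrite imset_f ?inE.
rewrite big_imset /=; last by move=> x y _ _ [].
by apply: eq_bigl => x; rewrite inE.
Qed.

Lemma sum_step n (t : tab n.+1) : valid t ->
  \sum_(o | valid ((t, o) : tab n.+2)) sgn ((t, o) : tab n.+2) =
  if t.2 is None then sgn t *+ 2 else 0.
Proof.
move=> Vt; have [b [bn Fb b_bottom]] := bottom_free_row Vt.
rewrite big_option [valid _](valid_addS t) Vt [sgn _](sgn_addS t).
rewrite (sum_addW Vt bn Fb b_bottom).
case: t => t [c|] in Vt Fb b_bottom *.
  by rewrite [counted _ _]counted_bottom_addW ?addrN.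
(* After a south step, row [n] is free and has the largest key of all. *)
suff -> : b = n by rewrite [counted _ _]counted_addS_new.
have := b_bottom n (leqnn _); rewrite [blocked _ n]blocked_addS_new => /(_ isT).
by rewrite /key /= eqxx; case: ifP => _; lia.
Qed.

Lemma sum_tabS n (G : tab n.+1 -> int) :
  \sum_(t : tab n.+1 | valid t) G t =
  \sum_(t : tab n | valid t)
    \sum_(o | valid ((t, o) : tab n.+1)) G ((t, o) : tab n.+1).
Proof.
rewrite pair_big_dep /=; apply: eq_big => [[t o]|[t o] _ //] /=.
case: o => [c|]; last by rewrite [valid _](valid_addS t) andbb.
by rewrite [valid _](valid_addW t c); case: (valid t).
Qed.

(** Removing the last step leaves twice the sum over tableaux that end with a south step, and
    removing that step preserves the sign. *)
Lemma sgn_sumSS n : sgn_sum n.+2 = sgn_sum n *+ 2.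
Proof.
rewrite /sgn_sum sum_tabS (eq_bigr _ (@sum_step n)) /= sum_tabS -sumrMnl.
apply: eq_bigr => t Vt.
by rewrite big_option [valid _](valid_addS t) Vt /= sgn_addS big1 ?addr0.
Qed.

Lemma sgn_sum0 : sgn_sum 0 = 1.
Proof.
rewrite /sgn_sum (big_pred1 tt) => [|[]]; first by rewrite /sgn big_ord0.
by rewrite /= eqxx; apply/andP; split; apply/exnP; case.
Qed.

(** A separate base case, since the empty tableau has no free row. The south step contributes 1, the
    west step with its diagonal 1 contributes -1. *)
Lemma sgn_sum1 : sgn_sum 1 = 0.
Proof.
have V0 : valid (tt : tab 0) by apply/andP; split; apply/exnP; case.
rewrite /sgn_sum sum_tabS (big_pred1 (tt : tab 0)) => [|[]]; last first.
  by rewrite V0 /= eqxx.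
rewrite big_option [valid _](valid_addS (tt : tab 0)) V0.
rewrite [sgn _](sgn_addS (tt : tab 0)) (big_pred1 [ffun=> true]) => [|c].
  by rewrite [X in _ + X]sgn_addW /sgn !big_ord0.
rewrite [valid _]valid_addW V0 /=; apply/andP/eqP => [[/exnP[[|//] _ c0] _]|->].
  by apply/ffunP => i; rewrite ffunE -colvE (ord1 i).
split; first by apply/exnP; exists 0%N; rewrite // (colv_ffun _ (fun=> true)).
by apply/exnP; case.
Qed.

Lemma sgn_sumE n : sgn_sum n = if odd n then 0 else 2 ^+ n./2.
Proof.
elim/ltn_ind: n => -[|[|n]] IHn; rewrite ?sgn_sum0 ?sgn_sum1 //.
rewrite sgn_sumSS IHn //= negbK; case: odd; first by rewrite mul0rn.
by rewrite exprS mulr2n mulrDl !mul1r.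
Qed.

(** * Labels and the bijection with sequences of columns *)

Lemma card_ord_lt n m : (m <= n)%N -> #|[set i : 'I_n | (i < m)%N]| = m.
Proof.
move=> mn; have -> : [set i : 'I_n | (i < m)%N] = widen_ord mn @: setT.
  apply/setP => i; rewrite inE.
  apply/idP/imsetP => [im|[j _ ->] /=]; last exact: ltn_ord.
  by exists (Ordinal im); rewrite ?inE //; apply: val_inj.
rewrite card_imset ?cardsT ?card_ord // => i j /(congr1 val) ij.
exact: val_inj.
Qed.

Fixpoint mktab n (w : nat -> bool) (M : nat -> nat -> bool) : tab n :=
  if n is m.+1 then
    (mktab m w M, if w m then Some [ffun i : 'I_m.+1 => M i m] else None)
  else tt.

Lemma west_mktab n w M j : (j < n)%N -> west (mktab n w M) j = w j.
Proof.
elim: n => //= n IHn; rewrite ltnS leq_eqVlt => /predU1P[->|jn].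
  by rewrite eqxx; case: (w n).
by rewrite ltn_eqF // IHn.
Qed.

Lemma entry_mktab n w M l j : (j < n)%N ->
  entry (mktab n w M) l j = [&& (l <= j)%N, w j & M l j].
Proof.
elim: n => //= n IHn; rewrite ltnS leq_eqVlt => /predU1P[->|jn].
  rewrite eqxx; case: (w n); rewrite ?andbF //=.
  by rewrite (colv_ffun _ (fun i => M i n)) ltnS.
by rewrite ltn_eqF // IHn.
Qed.

Lemma tab_ext n (t t' : tab n) :
    (forall j, (j < n)%N -> west t j = west t' j) ->
    (forall l j, (j < n)%N -> entry t l j = entry t' l j) ->
  t = t'.
Proof.
elim: n t t' => [[] []//|n IHn] [t o] [t' o'] W E; congr (_, _).
  apply: IHn => [j jn|l j jn].
    by have := W j (ltnW jn); rewrite /= ltn_eqF.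
  by have := E l j (ltnW jn); rewrite /= ltn_eqF.
have {W} := W n (leqnn _); have {E}E l := E l n (leqnn _).
move: E; rewrite /= eqxx; case: o o' => [c|] [c'|] //= E _; congr Some.
by apply/ffunP => i; have := E i; rewrite !colvE.
Qed.

Section Labels.
Variables (r k : nat) (F : ferrers r k).

Lemma row_length_le a : (row_length F a <= k)%N.
Proof. by rewrite -ltnS ltn_ord. Qed.

Lemma row_length_mono (a a' : 'I_r) :
  (a <= a')%N -> (row_length F a' <= row_length F a)%N.
Proof.
move=> aa'; have := valP F; rewrite /= => srt.
have geq_trans : transitive geq by move=> x y z /= xy yz; apply: leq_trans xy.
have := sorted_leq_nth geq_trans leqnn 0%N srt.
have sz : size [seq val l | l <- val F] = r by rewrite size_map size_tuple.
move=> /(_ a a'); rewrite !inE sz !ltn_ord => /(_ isT isT aa').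
have E b : nth 0%N [seq val l | l <- val F] (b : 'I_r) = row_length F b.
  by rewrite (nth_map ord0) ?size_tuple // /row_length (tnth_nth ord0).
by rewrite !E.
Qed.

Lemma col_height_le c : (col_height F c <= r)%N.
Proof. by rewrite -[X in (_ <= X)%N](card_ord r) max_card. Qed.

(** Row lengths decrease, so the rows that meet column [c] form an initial segment; its size is
    compared with that of the rows up to [a]. *)
Lemma col_heightE (a : 'I_r) (c : 'I_k) :
  (c < row_length F a)%N = (a < col_height F c)%N.
Proof.
apply/idP/idP => [ca|].
  rewrite -[X in (X <= _)%N](@card_ord_lt r a.+1) //.
  apply/subset_leq_card/subsetP => b; rewrite !inE ltnS => /row_length_mono.
  exact: leq_trans.
apply: contraLR; rewrite -!leqNgt => ac.
rewrite -[X in (_ <= X)%N](@card_ord_lt r a); last exact: ltnW.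
apply/subset_leq_card/subsetP => b; rewrite !inE; apply: contraLR.
rewrite -!leqNgt.
by move=> /row_length_mono /leq_trans; apply.
Qed.

Lemma col_height_mono (c c' : 'I_k) :
  (c <= c')%N -> (col_height F c' <= col_height F c)%N.
Proof.
move=> cc'; apply/subset_leq_card/subsetP => a; rewrite !inE.
exact: leq_ltn_trans.
Qed.

(** Labels counted from 0, with row -j sharing the label of column j; this makes [lab] a bijection
    from the rows of the shifted diagram to the boundary steps. *)
Definition lab (x : srow r k) : nat :=
  match x with
  | inl c => col_height F c + (k - c.+1)
  | inr a => a + (k - row_length F a)
  end.

Lemma lab_lt x : (lab x < r + k)%N.
Proof.
case: x => [c|a] /=.
  have := col_height_le c; have := ltn_ord c; lia.
have := ltn_ord a; lia.
Qed.

Lemma lab_col_lt (c c' : 'I_k) : (lab (inl c) < lab (inl c'))%N = (c' < c)%N.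
Proof.
rewrite /=; case: (leqP c c') => cc'.
  have := col_height_mono cc'; have := ltn_ord c; have := ltn_ord c'; lia.
have := col_height_mono (ltnW cc'); have := ltn_ord c; lia.
Qed.

Lemma lab_row_lt (a a' : 'I_r) : (lab (inr a) < lab (inr a'))%N = (a < a')%N.
Proof.
rewrite /=; case: (leqP a' a) => aa'.
  have := row_length_mono aa'; lia.
have := row_length_mono (ltnW aa'); have := row_length_le a; lia.
Qed.

Lemma lab_row_col (a : 'I_r) (c : 'I_k) :
  (lab (inr a) < lab (inl c))%N = (c < row_length F a)%N.
Proof.
have /= := col_heightE a c; have := row_length_le a; have := ltn_ord c; lia.
Qed.

Lemma lab_row_col_neq (a : 'I_r) (c : 'I_k) : lab (inr a) != lab (inl c).
Proof.
have /= := col_heightE a c; have := row_length_le a; have := ltn_ord c; lia.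
Qed.

Lemma lab_inj : injective lab.
Proof.
case=> [c|a] [c'|a'] /eqP E; first 1 last.
- by rewrite eq_sym (negPf (lab_row_col_neq _ _)) in E.
- by rewrite (negPf (lab_row_col_neq _ _)) in E.
- congr inr; apply/val_inj; have := lab_row_lt a a'; have := lab_row_lt a' a.
  by rewrite (eqP E) ltnn; case: ltngtP.
congr inl; apply/val_inj; have := lab_col_lt c c'; have := lab_col_lt c' c.
by rewrite (eqP E) ltnn; case: ltngtP.
Qed.

Definition olab (x : srow r k) : 'I_(r + k) := Ordinal (lab_lt x).

Lemma olab_bij : bijective olab.
Proof.
apply: inj_card_bij; first by move=> x y [] /lab_inj.
by rewrite card_sum !card_ord addnC.
Qed.

Lemma lab_surj l : (l < r + k)%N -> exists x, lab x = l.
Proof.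
move=> lt_l; case: olab_bij => g _ gK; exists (g (Ordinal lt_l)).
by rewrite -[RHS]/(nat_of_ord (Ordinal lt_l)) -{2}[Ordinal _]gK.
Qed.

Lemma in_shiftedE x (c : 'I_k) :
  in_shifted F (x, c) = (lab x <= lab (inl c))%N.
Proof.
case: x => [d|a]; first by rewrite /in_shifted leqNgt lab_col_lt -leqNgt.
by rewrite leq_eqVlt (negPf (lab_row_col_neq _ _)) lab_row_col.
Qed.

End Labels.

(** * Agreement of the statistics under the encoding *)

Section Encoding.
Variables (r k : nat) (F : ferrers r k) (T : filling F).

(** The length [n] is a separate parameter, tied to [r + k] by an equation, because [n - k + k] and
    [n] are not convertible. *)
Definition encode n : tab n :=
  mktab n (fun j => [exists c : 'I_k, lab F (inl c) == j])
    (fun l j => [exists x : cell F,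
       [&& T x, lab F (cell_row x) == l & lab F (inl (cell_col x)) == j]]).

Variable n : nat.
Hypothesis rkn : (r + k = n)%N.

Let E : tab n := encode n.
Let row (x : cell F) : nat := lab F (cell_row x).
Let col (x : cell F) : nat := lab F (inl (cell_col x)).

Let lab_ltn x : (lab F x < n)%N.
Proof. by rewrite -rkn lab_lt. Qed.

Let cell_le x : (row x <= col x)%N.
Proof. by rewrite -in_shiftedE; case: x => -[]. Qed.

Let cell_inj x y : row x = row y -> col x = col y -> x = y.
Proof.
move=> /lab_inj rxy /lab_inj[cxy]; apply: val_inj.
by move: rxy cxy; rewrite /cell_row /cell_col; do 2!case: (val _) => ? ? /=;
  move=> -> ->.
Qed.

Lemma west_encode_col c : west E (lab F (inl c)).
Proof. by rewrite west_mktab ?lab_ltn //; apply/existsP; exists c. Qed.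

Lemma west_encode_row a : west E (lab F (inr a)) = false.
Proof.
rewrite west_mktab ?lab_ltn //; apply/existsP => -[c].
by rewrite eq_sym (negPf (lab_row_col_neq F a c)).
Qed.

Lemma entry_encode x : entry E (row x) (col x) = T x.
Proof.
rewrite entry_mktab ?lab_ltn // cell_le /=.
have -> /= : [exists c, lab F (inl c) == col x].
  by apply/existsP; exists (cell_col x).
apply/existsP/idP => [[y /and3P[Ty /eqP ry /eqP cy]]|Tx].
  by rewrite -(cell_inj ry cy).
by exists x; rewrite Tx !eqxx.
Qed.

Lemma west_encodeP j : west E j -> exists c, lab F (inl c) = j.
Proof.
move=> Wj; have : (j < r + k)%N by rewrite rkn (west_lt Wj).
case/(lab_surj F) => -[c|a] lj; first by exists c.
by rewrite -lj west_encode_row in Wj.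
Qed.

Lemma cell_encodeP l j : (l <= j)%N -> west E j ->
  exists x, row x = l /\ col x = j.
Proof.
move=> lj /west_encodeP[c cj]; have: (l < r + k)%N.
  by rewrite rkn (leq_ltn_trans lj) // -cj.
case/(lab_surj F) => x xl; rewrite -xl -cj -in_shiftedE in lj.
by exists (exist _ (x, c) lj).
Qed.

Lemma entry_encodeP l j : entry E l j ->
  exists x, [/\ row x = l, col x = j & T x].
Proof.
move=> Elj; case/andP: (entryP Elj) => lj /(cell_encodeP lj)[x [xl xj]].
by exists x; split=> //; rewrite -entry_encode xl xj.
Qed.

(** Column labels decrease from left to right, so the added rows, whose lengths grow downwards, have
    decreasing labels. *)
Lemma key_encode_lt x y :
  (key E (lab F x) < key E (lab F y)) = (srow_pos x < srow_pos y)%N.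
Proof.
rewrite /key; case: x => [c|a]; case: y => [c'|a'];
  rewrite ?west_encode_col ?west_encode_row /srow_pos.
- by rewrite -[RHS](lab_col_lt F).
- have := ltn_ord c; lia.
- have := ltn_ord c'; lia.
by rewrite ltn_add2l -[RHS](lab_row_lt F).
Qed.

Lemma above_encode x : above E (row x) (col x) = one_above T x.
Proof.
apply/exnP/existsP => [[i _ /andP[/entry_encodeP[y [yi yx Ty]]]]|].
  rewrite -yi key_encode_lt => yx'; exists y; rewrite Ty yx' andbT.
  by apply/eqP; case: (lab_inj yx).
case=> y /and3P[Ty /eqP cyx pyx]; exists (row y); first exact: lab_ltn.
by rewrite key_encode_lt pyx andbT /col -cyx entry_encode.
Qed.

Lemma leftof_encode x : leftof E (row x) (col x) = one_left T x.
Proof.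
apply/exnP/existsP => [[i _ /andP[/entry_encodeP[y [yx yi Ty]]]]|].
  rewrite -yi lab_col_lt => lt_yx; exists y; rewrite Ty lt_yx andbT.
  by apply/eqP; apply: lab_inj yx.
case=> y /and3P[Ty /eqP ryx lt_yx]; exists (col y); first exact: lab_ltn.
by rewrite lab_col_lt lt_yx andbT /row -ryx entry_encode.
Qed.

Lemma diagonal_encode x : (row x == col x) = diagonal x.
Proof. by rewrite (inj_eq (@lab_inj _ _ F)). Qed.

Lemma valid_encode : valid E = is_PTB T.
Proof.
apply/andP/and3P => [[/exnP V1 /exnP V2]|].
  (* The merged form of the two conditions on 0s, split again below. *)
  have V3 x : ~~ T x -> one_left T x -> diagonal x || one_above T x -> False.
    move=> Tx Lx Dx; case: V2; exists (col x); first exact: lab_ltn.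
    rewrite west_encode_col /=; apply/exnP; exists (row x).
      exact: lab_ltn.
    by rewrite cell_le entry_encode Tx leftof_encode diagonal_encode
      above_encode Lx Dx.
  split.
  - apply/forallP => c; apply/existsP.
    case: (boolP (exn n (fun l => entry E l (lab F (inl c))))).
      case/exnP => l _ /entry_encodeP[x [_ /lab_inj[xc] Tx]].
      by exists x; rewrite xc eqxx.
    move=> nE; case: V1; exists (lab F (inl c)) => //.
    by rewrite west_encode_col nE.
  - apply/forallP => x; apply/implyP => Tx; apply/negP => /andP[Ax Lx].
    by apply: (V3 x); rewrite ?Ax ?orbT.
  apply/forallP => x; apply/implyP => /andP[Tx Dx]; apply/negP => Lx.
  by apply: (V3 x); rewrite ?Dx.
case=> /forallP P1 /forallP P2 /forallP P3; split; apply/exnP => -[j _].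
  case/andP => /west_encodeP[c <-] /exnP[].
  have /existsP[x /andP[/eqP xc Tx]] := P1 c.
  exists (row x); first exact: lab_ltn.
  by rewrite -xc entry_encode.
case/andP => Wj /exnP[l _ /and4P[lj]].
have [x [<- <-]] := cell_encodeP lj Wj.
rewrite entry_encode diagonal_encode above_encode leftof_encode => Tx Dx Lx.
have := P2 x; have := P3 x; rewrite Tx Lx /= andbT.
by case/orP: Dx => ->.
Qed.

Definition counted_row (x : srow r k) : bool :=
  ~~ has_row_restricted0 T x &&
  match x with
  | inl c => ~~ has_col_restricted0 T c
  | inr a => [exists x : cell F, (cell_row x == inr a) && T x]
  end.

Lemma counted_encode x : counted E (lab F x) = counted_row x.
Proof.
rewrite /counted /counted_row; case: x => [c|a].
  rewrite west_encode_col andbC; congr (~~ _ && ~~ _).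
    apply/exnP/existsP => [[j _ /and4P[cj Wj]]|].
      have [x [xc xj]] := cell_encodeP (ltnW cj) Wj.
      rewrite -xc -xj in cj *; rewrite entry_encode above_encode => Tx Ax.
      exists x; rewrite /row_restricted0 Tx Ax -diagonal_encode ltn_eqF //.
      by rewrite !andbT; apply/eqP/(@lab_inj _ _ F).
    case=> x /andP[/eqP xc /and3P[Tx]]; rewrite -diagonal_encode => Dx Ax.
    exists (col x); first exact: lab_ltn.
    rewrite -xc -/(row x) ltn_neqAle Dx cell_le west_encode_col.
    by rewrite entry_encode Tx above_encode.
  apply/exnP/existsP => [[l _ /and3P[lc]]|].
    have [x [xl xc]] := cell_encodeP lc (west_encode_col c).
    rewrite -xc -xl entry_encode leftof_encode => Tx Lx; exists x.
    by rewrite /col_restricted0 Tx Lx !andbT; case: (lab_inj xc) => ->.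
  case=> x /andP[/eqP <- /andP[Tx Lx]]; exists (row x).
    exact: lab_ltn.
  by rewrite cell_le entry_encode Tx leftof_encode.
rewrite west_encode_row; congr (~~ _ && _).
  apply/exnP/existsP => [[j _ /and4P[aj Wj]]|].
    have [x [xa xj]] := cell_encodeP aj Wj.
    rewrite -xa -xj entry_encode above_encode diagonal_encode => Tx.
    have /negPf Dx : ~~ diagonal x.
      by rewrite -diagonal_encode xa lab_row_col_neq.
    rewrite Dx /= => Ax; exists x; rewrite /row_restricted0 Tx Ax Dx !andbT.
    by apply/eqP/(@lab_inj _ _ F).
  case=> x /andP[/eqP xa /and3P[Tx Dx Ax]]; exists (col x).
    exact: lab_ltn.
  by rewrite -xa -/(row x) cell_le west_encode_col entry_encode above_encode Tx
     Ax orbT.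
apply/exnP/existsP => [[j _ /entry_encodeP[x [xa _ Tx]]]|].
  by exists x; rewrite Tx andbT; apply/eqP/(@lab_inj _ _ F).
case=> x /andP[/eqP xa Tx]; exists (col x); first exact: lab_ltn.
by rewrite -xa entry_encode.
Qed.

(** Row labels and column labels are disjoint and all distinct, so counting labels in the union
    amounts to counting rows of the shifted diagram. *)
Lemma urBE : urB T = #|[set x | counted_row x]|.
Proof.
(* [lift ord0] adds 1, passing from labels counted from 0 to the actual ones. *)
pose f (x : srow r k) : 'I_(r + k).+1 := lift ord0 (olab F x).
have f_inj : injective f.
  by move=> x y /lift_inj /(bij_inj (olab_bij F)).
rewrite -(card_imset _ f_inj) /urB; congr #|pred_of_set _|.
have fE x : val (f x) = (lab F x).+1 by [].
apply/setP => l; rewrite !inE; apply/orP/imsetP.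
  case=> /existsP[a /and3P[/eqP la H1 H2]].
    by exists (inr a); [rewrite inE /counted_row H1 H2|apply: val_inj].
  by exists (inl a); [rewrite inE /counted_row H1 H2|apply: val_inj].
case=> -[c|a]; rewrite inE => /andP[H1 H2] ->; [right|left]; apply/existsP.
  by exists c; rewrite H1 H2 fE eqxx.
by exists a; rewrite H1 H2 fE eqxx.
Qed.

Lemma sgn_encode : sgn E = signB T.
Proof.
pose h x : 'I_n := Ordinal (lab_ltn x).
have h_bij : bijective h.
  apply: inj_card_bij; first by move=> x y [] /lab_inj.
  by rewrite card_sum !card_ord addnC rkn.
rewrite /signB urBE -sum1_card -prodrXr big_mkcond /sgn.
rewrite (reindex h) /=; last exact: onW_bij.
by apply: eq_bigr => x _; rewrite counted_encode inE; case: counted_row.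
Qed.

(** Allows the diagram to be recovered from its encoding: the number of south steps gives the number
    of rows, and the label of each row gives its length. *)
Lemma lab_rows_encode :
  [seq lab F (inr a) | a <- enum 'I_r] = [seq l <- iota 0 n | ~~ west E l].
Proof.
apply: (irr_sorted_eq ltn_trans ltnn).
- have : sorted ltn (map val (enum 'I_r)).
    by rewrite val_enum_ord iota_ltn_sorted.
  by rewrite !sorted_map; apply: sub_sorted => a b; rewrite /= lab_row_lt.
- by rewrite sorted_filter ?iota_ltn_sorted //; apply: ltn_trans.
move=> l; rewrite mem_filter mem_iota leq0n add0n.
apply/mapP/andP => [[a _ ->]|].
  by rewrite west_encode_row lab_ltn.
case=> Wl; rewrite -[X in (_ < X)%N]rkn => /(lab_surj F)[[c|a] xl].
  by rewrite -xl west_encode_col in Wl.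
by exists a; rewrite ?mem_enum.
Qed.

End Encoding.

(** * Bijectivity of the encoding *)

Lemma encode_inj r k (F : ferrers r k) (T T' : filling F) n :
  (r + k = n)%N -> encode T n = encode T' n -> T = T'.
Proof.
move=> rkn TT'; apply/ffunP => x.
by rewrite -(entry_encode T rkn) TT' entry_encode.
Qed.

Lemma ferrers_eq r k (F F' : ferrers r k) :
  (forall a, lab F (inr a) = lab F' (inr a)) -> F = F'.
Proof.
move=> FF'; apply/val_inj/eq_from_tnth => a; apply: val_inj.
rewrite -[LHS]/(row_length F a) -[RHS]/(row_length F' a).
have /= := FF' a; have := row_length_le F a; have := row_length_le F' a; lia.
Qed.

Definition enc n (s : shifted_filling n) : tab n :=
  encode (tagged (tagged s)) n.

Lemma shifted_size n (k : 'I_n.+1) : (n - k + k = n)%N.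
Proof. by rewrite subnK // -ltnS. Qed.

Lemma enc_inj n : injective (@enc n).
Proof.
move=> [k [F T]] [k' [F' T']]; rewrite /enc /= => TT'.
have rows := lab_rows_encode T (shifted_size k).
rewrite TT' -(lab_rows_encode T' (shifted_size k')) in rows.
have kk' : k = k'.
  apply: val_inj; have := congr1 size rows; rewrite 2!size_map 2!size_enum_ord.
  by have := ltn_ord k; have := ltn_ord k'; rewrite /=; lia.
case: k' / kk' in F' T' TT' rows *.
have FF' : F = F'.
  apply: ferrers_eq => a; have /eq_in_map := rows; apply.
  by rewrite mem_enum.
case: F' / FF' in T' TT' rows *.
by rewrite (encode_inj (shifted_size k) TT').
Qed.

(** Applied to the increasing list of south labels, this bounds the row lengths and shows that they
    decrease weakly. *)
Lemma sorted_nth_gap s a b : sorted ltn s -> (a <= b)%N -> (b < size s)%N ->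
  (nth 0 s a + (b - a) <= nth 0 s b)%N.
Proof.
move=> srt; elim: b => [|b IHb].
  by rewrite leqn0 => /eqP->; rewrite subnn addn0.
rewrite leq_eqVlt => /predU1P[->|]; first by rewrite subnn addn0.
rewrite ltnS => ab bs; have {}IHb := IHb ab (ltnW bs).
have := sorted_ltn_nth ltn_trans 0%N srt; move=> /(_ b b.+1).
by rewrite !inE => /(_ (ltnW bs) bs (leqnn _)); lia.
Qed.

Lemma enc_surj n (t : tab n) : exists s, enc s = t.
Proof.
pose ss := [seq l <- iota 0 n | ~~ west t l].
have srt : sorted ltn ss.
  by rewrite sorted_filter ?iota_ltn_sorted //; apply: ltn_trans.
have mem_ss l : (l \in ss) = ~~ west t l && (l < n)%N.
  by rewrite mem_filter mem_iota.
have size_ss : (size ss <= n)%N.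
  by rewrite size_filter -[X in (_ <= X)%N](size_iota 0) count_size.
pose k : 'I_n.+1 := inord (n - size ss).
have kE : k = (n - size ss)%N :> nat by rewrite inordK // ltnS leq_subr.
have rE : (n - k)%N = size ss by rewrite kE subKn.
pose f a := nth 0%N ss a.
(* Comparison with the last south label, which is at most [n - 1]. *)
have f_le a : (a < n - k)%N -> (f a - a <= k)%N.
  rewrite rE => am; have f_lt : (f (size ss).-1 < n)%N.
    have : f (size ss).-1 \in ss.
      by rewrite mem_nth // ltn_predL (leq_ltn_trans _ am).
    by rewrite mem_ss => /andP[].
  have : (f a + ((size ss).-1 - a) <= f (size ss).-1)%N.
    by apply: sorted_nth_gap => //; lia.
  move: kE am f_lt size_ss; move: (size ss) => m; lia.
have f_ge a : (a < n - k)%N -> (a <= f a)%N.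
  rewrite rE => am; have := sorted_nth_gap srt (leq0n a) am.
  by rewrite subn0 -/(f a); apply: leq_trans; rewrite leq_addl.
(* Of the [f a] steps before row [a], [a] are south and [f a - a] are west; each of the latter
   shortens the row by one. *)
pose Ft : (n - k).-tuple 'I_k.+1 := [tuple inord (k - (f a - a)) | a < n - k].
have FtE a : tnth Ft a = (k - (f a - a))%N :> nat.
  by rewrite tnth_mktuple inordK // ltnS leq_subr.
have Fsrt : sorted geq [seq val l | l <- Ft].
  apply/(sortedP 0%N) => i; rewrite size_map size_tuple => lt_i.
  have lt_i' := ltnW lt_i.
  rewrite !(nth_map ord0) ?size_tuple //.
  have -> : nth ord0 Ft i = tnth Ft (Ordinal lt_i') by rewrite (tnth_nth ord0).
  have -> : nth ord0 Ft i.+1 = tnth Ft (Ordinal lt_i).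
    by rewrite (tnth_nth ord0).
  have : (f i + (i.+1 - i) <= f i.+1)%N.
    by apply: sorted_nth_gap; rewrite -?rE.
  rewrite /= !FtE /=; lia.
pose F : ferrers (n - k) k := exist _ Ft Fsrt.
have labE a : lab F (inr a) = f a.
  rewrite /= /row_length FtE; have := f_le a; have := f_ge a.
  by have := ltn_ord a; lia.
pose T : filling F :=
  [ffun x => entry t (lab F (cell_row x)) (lab F (inl (cell_col x)))].
exists (existT (fun k : 'I_n.+1 => {F : ferrers (n - k) k & filling F}) k
  (existT (fun F => filling F : Type) F T)).
(* Row labels are the south steps by [labE]; column labels avoid them, hence are west steps. *)
have W j : (j < n)%N -> west (encode T n) j = west t j.
  rewrite -{1}(shifted_size k) => /(lab_surj F)[[c|a] <-].
    rewrite west_encode_col ?shifted_size //; apply/esym/negPn/negP => Wt.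
    have : lab F (inl c) \in ss.
      by rewrite mem_ss Wt -[X in (_ < X)%N](shifted_size k) lab_lt.
    case/(nthP 0%N) => a; rewrite -rE => am fa.
    have := lab_row_col_neq F (Ordinal am) c.
    by rewrite labE /= /f fa eqxx.
  rewrite west_encode_row ?shifted_size //; apply/esym/negbTE.
  have : f a \in ss by rewrite mem_nth // -rE.
  by rewrite mem_ss labE => /andP[].
apply: tab_ext => // l j jn.
apply/idP/idP => [/entry_encodeP[]|Et]; first exact: shifted_size.
  by move=> x [<- <-]; rewrite ffunE.
case/andP: (entryP Et) => lj Wj.
have [x [xl xj]] : exists x : cell F,
    lab F (cell_row x) = l /\ lab F (inl (cell_col x)) = j.
  by rewrite -W // in Wj; apply: cell_encodeP (shifted_size k) _ _ lj Wj.
by rewrite -xl -xj entry_encode ?shifted_size // ffunE xl xj.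
Qed.

Lemma sB_sgn_sum n : sB n = sgn_sum n.
Proof.
have enc_bij : bijective (@enc n).
  have surj (t : tab n) : exists s, enc s == t.
    by case: (@enc_surj n t) => s <-; exists s.
  exists (fun t => xchoose (surj t)) => [s|t]; last first.
    exact: (eqP (xchooseP (surj t))).
  by apply: (@enc_inj n); apply: (eqP (xchooseP (surj (enc s)))).
rewrite /sgn_sum (reindex (@enc n)) /=; last exact: onW_bij.
apply: eq_big => [s|s _]; last by rewrite sgn_encode ?shifted_size.
by rewrite inE valid_encode ?shifted_size.
Qed.

Theorem theorem3p1 (n : nat) :
  sB n = (if odd n then 0 else 2 ^+ (n./2)) :> int.
Proof. by rewrite sB_sgn_sum sgn_sumE. Qed.
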